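(* The functor $\mathcal O$ (respectively $\mathcal O_h$, $\mathcal O_l$, $\mathcal O_{l,h}$) is monomorphic. That is, for a fixed $K$ in $Ob(\mathcal K_w)$ (respectively $Ob(\mathcal K_{w,l})$, $Ob(\mathcal K)$, $Ob(\mathcal K_l)$), it sends every monomorphism $s:X\to Y$ of sets (of linearly ordered sets with non-decreasing maps, in the cases $\mathcal O_l$ and $\mathcal O_{l,h}$) to an injective map $\mathcal O(s):\mathcal O(X,K)\to\mathcal O(Y,K)$ (respectively $\mathcal O_h(s)$, $\mathcal O_l(s)$, $\mathcal O_{l,h}(s)$).
   Context: Quasirings. A quasiring is a set $K$ with operations $+,\times$ such that $K$ under $+$ and $K\setminus\{0\}$ under $\times$ are groupoids (sets with a binary operation) with neutral elements $0$ and $1$, $a0=0a=0$ for all $a$, and left distributivity $a(b+c)=ab+ac$ or right distributivity $(b+c)a=ba+ca$ holds (no associativity or commutativity is required). Orders. A set is directed by $\le$ if $\le$ is transitive, reflexive and any two elements have a common upper bound; $x<y$ means $x\le y$, $x\ne y$. Linearly ordered: $<$ is transitive, asymmetric, and any two distinct elements are comparable. Well-ordered: linearly ordered and each non-void subset has a least element. An ordered quasiring has order-preserving operations: $a+b\le c+d$ and $ab\le cd$ whenever $a\le c$, $b\le d$ and $a,b,c,d$ lie in a common linearly ordered subset; its minimal element is $0$. Condition (DW): every linearly ordered subset is contained in a well-ordered subset. $\mathcal K$ is the category of directed quasirings satisfying (DW), with order-preserving algebraic homomorphisms; $\mathcal K_w$ is its subcategory of well-ordered quasirings; $\mathcal K_l$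 and $\mathcal K_{w,l}$ are the subcategories of left distributive quasirings in $\mathcal K$ and $\mathcal K_w$. Function spaces. $C(X,K)$ is the set of all maps $X\to K$ with pointwise operations and order; for linearly ordered $X$, $C_+(X,K)$ is the set of monotone non-decreasing maps. It is a standing assumption that $\sup f(X)$ exists in $K$ for every $f$ in $C(X,K)$ (resp. $C_+(X,K)$). $g^c$ denotes the constant map with value $c\in K$. Functionals. $\nu:C(X,K)\to K$ is order preserving if $f\le h$ implies $\nu(f)\le\nu(h)$; weakly additive if $\nu(h+g^c)=\nu(h)+c$ and $\nu(g^c+h)=c+\nu(h)$; left homogeneous if $\nu(bf)=b\,\nu(f)$ for $b\in K$; similarly on $C_+(X,K)$. $\mathcal O(X,K)$ (resp. $\mathcal O_l(X,K)$) is the set of order preserving weakly additive functionals on $C(X,K)$ (resp. $C_+(X,K)$); $\mathcal O_h(X,K)$, $\mathcal O_{l,h}(X,K)$ are their subsets of left homogeneous functionals. For $f:X\to Y$ (non-decreasing in the cases with index $l$), $(\mathcal O(f)(\nu))(g)=\nu(g\circ f)$ for $g\in C(Y,K)$ (resp. $C_+(Y,K)$), and likewise for $\mathcal O_h,\mathcal O_l,\mathcal O_{l,h}$. $\mathcal O,\mathcal O_h$ are functors on the category of sets; $\mathcal O_l,\mathcal O_{l,h}$ on the category of linearly ordered sets and non-decreasing maps. A covariant functor is monomorphic if it preserves monomorphisms. *)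

(* Defs.v *)
From mathcomp Require Import all_boot all_order.
From mathcomp Require Import boolp classical_sets.

Set Implicit Arguments.
Unset Strict Implicit.
Unset Printing Implicit Defensive.

Local Open Scope classical_set_scope.

Section Orders.
Variables (T : Type) (le : T -> T -> Prop).

(* [le] is only assumed reflexive and transitive in general, so this is not
   the strict part of a preorder: both [strict x y] and [strict y x] may hold. *)
Definition strict (x y : T) : Prop := le x y /\ x <> y.

Definition directed : Prop :=
  [/\ forall x, le x x,
      forall x y z, le x y -> le y z -> le x z
    & forall x y, exists z, le x z /\ le y z].

Definition linearly_ordered (A : set T) : Prop :=
  [/\ forall x y z, A x -> A y -> A z ->
        strict x y -> strict y z -> strict x z,
      forall x y, A x -> A y -> strict x y -> ~ strict y x
    & forall x y, A x -> A y -> x <> y -> strict x y \/ strict y x].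

Definition well_ordered (A : set T) : Prop :=
  linearly_ordered A /\
  forall B : set T, B `<=` A -> B !=set0 ->
    exists m, B m /\ forall x, B x -> le m x.

Definition minimal_element (m : T) : Prop := forall x, ~ strict x m.

Definition is_supremum (A : set T) (k : T) : Prop :=
  (forall x, A x -> le x k) /\
  (forall u, (forall x, A x -> le x u) -> le k u).

End Orders.

Record quasiring : Type := Quasiring {
  quasiring_sort :> Type;
  qzero : quasiring_sort;
  qone : quasiring_sort;
  qadd : quasiring_sort -> quasiring_sort -> quasiring_sort;
  qmul : quasiring_sort -> quasiring_sort -> quasiring_sort;
  qadd0l : forall a, qadd qzero a = a;
  qadd0r : forall a, qadd a qzero = a;
  qone_neq0 : qone <> qzero;
  qmul_neq0 : forall a b, a <> qzero -> b <> qzero -> qmul a b <> qzero;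
  qmul1l : forall a, a <> qzero -> qmul qone a = a;
  qmul1r : forall a, a <> qzero -> qmul a qone = a;
  qmul0l : forall a, qmul qzero a = qzero;
  qmul0r : forall a, qmul a qzero = qzero;
  qdistr :
    (forall a b c, qmul a (qadd b c) = qadd (qmul a b) (qmul a c)) \/
    (forall a b c, qmul (qadd b c) a = qadd (qmul b a) (qmul c a))
}.

Declare Scope quasiring_scope.
Delimit Scope quasiring_scope with QR.
Notation "a + b" := (qadd a b) : quasiring_scope.
Notation "a * b" := (qmul a b) : quasiring_scope.
Local Open Scope quasiring_scope.

(* The convention is opposite to the one of [ssrfun.left_distributive]. *)
Definition left_distributive_quasiring (K : quasiring) : Prop :=
  forall a b c : K, a * (b + c) = a * b + a * c.

(* The objects of the category of directed quasirings satisfying (DW). *)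
Record directed_quasiring : Type := DirectedQuasiring {
  dq_quasiring :> quasiring;
  qle : dq_quasiring -> dq_quasiring -> Prop;
  qle_directed : directed qle;
  qle_add : forall (L : set dq_quasiring) (a b c d : dq_quasiring),
    linearly_ordered qle L -> L a -> L b -> L c -> L d ->
    qle a c -> qle b d -> qle (a + b) (c + d);
  qle_mul : forall (L : set dq_quasiring) (a b c d : dq_quasiring),
    linearly_ordered qle L -> L a -> L b -> L c -> L d ->
    qle a c -> qle b d -> qle (a * b) (c * d);
  (* 0 is the minimal element: it is minimal and there is no other one. *)
  qle_minimal : forall a, minimal_element qle a <-> a = qzero dq_quasiring;
  qle_DW : forall A : set dq_quasiring, linearly_ordered qle A ->
    exists B : set dq_quasiring, A `<=` B /\ well_ordered qle B
}.

Definition well_ordered_quasiring (K : directed_quasiring) : Prop :=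
  well_ordered (@qle K) [set: K].

Section FunctionSpaces.
Variable K : directed_quasiring.

Definition qle_fun (X : Type) (f h : X -> K) : Prop := forall x, qle (f x) (h x).

Definition has_sups (X : Type) : Prop :=
  forall f : X -> K, exists k, is_supremum (@qle K) (range f) k.

Definition order_preserving (X : Type) (nu : (X -> K) -> K) : Prop :=
  forall f h, qle_fun f h -> qle (nu f) (nu h).

Definition weakly_additive (X : Type) (nu : (X -> K) -> K) : Prop :=
  forall (h : X -> K) (c : K),
    nu (fun x => h x + c) = nu h + c /\ nu (fun x => c + h x) = c + nu h.

Definition left_homogeneous (X : Type) (nu : (X -> K) -> K) : Prop :=
  forall (b : K) (f : X -> K), nu (fun x => b * f x) = b * nu f.

Definition O_space (X : Type) : Type :=
  {nu : (X -> K) -> K | order_preserving nu /\ weakly_additive nu}.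

Definition Oh_space (X : Type) : Type :=
  {nu : (X -> K) -> K |
    (order_preserving nu /\ weakly_additive nu) /\ left_homogeneous nu}.

Definition pushforward (X Y : Type) (f : X -> Y) (nu : (X -> K) -> K) :
  (Y -> K) -> K := fun g => nu (g \o f).

Lemma pushforward_O (X Y : Type) (f : X -> Y) (nu : (X -> K) -> K) :
  order_preserving nu /\ weakly_additive nu ->
  order_preserving (pushforward f nu) /\ weakly_additive (pushforward f nu).
Proof.
move=> [nule nuD]; split=> [g h gh|h c]; first by apply: nule => x; apply: gh.
exact: nuD (h \o f) c.
Qed.

Lemma pushforward_Oh (X Y : Type) (f : X -> Y) (nu : (X -> K) -> K) :
  (order_preserving nu /\ weakly_additive nu) /\ left_homogeneous nu ->
  (order_preserving (pushforward f nu) /\ weakly_additive (pushforward f nu)) /\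
  left_homogeneous (pushforward f nu).
Proof.
move=> [nuO nuh]; split=> [|b g]; first exact: pushforward_O.
exact: nuh b (g \o f).
Qed.

Definition O_map (X Y : Type) (f : X -> Y) (nu : O_space X) : O_space Y :=
  exist _ (pushforward f (sval nu)) (pushforward_O f (svalP nu)).

Definition Oh_map (X Y : Type) (f : X -> Y) (nu : Oh_space X) : Oh_space Y :=
  exist _ (pushforward f (sval nu)) (pushforward_Oh f (svalP nu)).

End FunctionSpaces.

Definition nondecreasing_map (d d' : Order.disp_t) (X : orderType d)
  (Y : orderType d') (f : X -> Y) : Prop := {homo f : x y / (x <= y)%O}.

Section MonotoneFunctionSpaces.
Variable K : directed_quasiring.

Definition nondecreasing_fun (d : Order.disp_t) (X : orderType d) (f : X -> K) :
  Prop := forall x y : X, (x <= y)%O -> qle (f x) (f y).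

Definition Cplus (d : Order.disp_t) (X : orderType d) : Type :=
  {f : X -> K | nondecreasing_fun f}.

Definition has_sups_l (d : Order.disp_t) (X : orderType d) : Prop :=
  forall f : Cplus X, exists k, is_supremum (@qle K) (range (sval f)) k.

Definition order_preserving_l (d : Order.disp_t) (X : orderType d)
  (nu : Cplus X -> K) : Prop :=
  forall f h : Cplus X, qle_fun (sval f) (sval h) -> qle (nu f) (nu h).

(* When K is not linearly ordered, translating or multiplying a non-decreasing
   map by a constant need not give a non-decreasing map; [h'] ranges over the
   cases where it does. *)
Definition weakly_additive_l (d : Order.disp_t) (X : orderType d)
  (nu : Cplus X -> K) : Prop :=
  forall (h h' : Cplus X) (c : K),
    (sval h' = (fun x => sval h x + c) -> nu h' = nu h + c) /\
    (sval h' = (fun x => c + sval h x) -> nu h' = c + nu h).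

Definition left_homogeneous_l (d : Order.disp_t) (X : orderType d)
  (nu : Cplus X -> K) : Prop :=
  forall (f f' : Cplus X) (b : K),
    sval f' = (fun x => b * sval f x) -> nu f' = b * nu f.

Definition Ol_space (d : Order.disp_t) (X : orderType d) : Type :=
  {nu : Cplus X -> K | order_preserving_l nu /\ weakly_additive_l nu}.

Definition Olh_space (d : Order.disp_t) (X : orderType d) : Type :=
  {nu : Cplus X -> K |
    (order_preserving_l nu /\ weakly_additive_l nu) /\ left_homogeneous_l nu}.

Section Pushforward.
Variables (d d' : Order.disp_t) (X : orderType d) (Y : orderType d').
Variables (f : X -> Y) (f_mono : nondecreasing_map f).

Lemma Cplus_comp_subproof (g : Cplus Y) : nondecreasing_fun (sval g \o f).
Proof. by move=> x y xy; apply: (svalP g); apply: f_mono. Qed.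

Definition Cplus_comp (g : Cplus Y) : Cplus X :=
  exist _ (sval g \o f) (Cplus_comp_subproof g).

Definition pushforward_l (nu : Cplus X -> K) : Cplus Y -> K :=
  fun g => nu (Cplus_comp g).

Lemma pushforward_Ol (nu : Cplus X -> K) :
  order_preserving_l nu /\ weakly_additive_l nu ->
  order_preserving_l (pushforward_l nu) /\ weakly_additive_l (pushforward_l nu).
Proof.
move=> [nule nuD]; split=> [g h gh|h h' c]; first by apply: nule => x; apply: gh.
by split=> e; apply nuD; rewrite /= e.
Qed.

Lemma pushforward_Olh (nu : Cplus X -> K) :
  (order_preserving_l nu /\ weakly_additive_l nu) /\ left_homogeneous_l nu ->
  (order_preserving_l (pushforward_l nu) /\
   weakly_additive_l (pushforward_l nu)) /\
  left_homogeneous_l (pushforward_l nu).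
Proof.
move=> [nuO nuh]; split=> [|g g' b e]; first exact: pushforward_Ol.
by apply: nuh; rewrite /= e.
Qed.

Definition Ol_map (nu : Ol_space X) : Ol_space Y :=
  exist _ (pushforward_l (sval nu)) (pushforward_Ol (svalP nu)).

Definition Olh_map (nu : Olh_space X) : Olh_space Y :=
  exist _ (pushforward_l (sval nu)) (pushforward_Olh (svalP nu)).

End Pushforward.
End MonotoneFunctionSpaces.

Definition set_monomorphism (X Y : Type) (s : X -> Y) : Prop :=
  forall (Z : Type) (g h : Z -> X), s \o g = s \o h -> g = h.

Definition linear_monomorphism (d d' : Order.disp_t) (X : orderType d)
  (Y : orderType d') (s : X -> Y) : Prop :=
  nondecreasing_map s /\
  forall (d'' : Order.disp_t) (Z : orderType d'') (g h : Z -> X),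
    nondecreasing_map g -> nondecreasing_map h -> s \o g = s \o h -> g = h.

(* Main.v *)
Require Import Defs.
From mathcomp Require Import all_boot all_order.
From mathcomp Require Import boolp classical_sets.

(** A functional on the maps [Y -> K] of the form [g |-> nu (g \o s)] determines
    [nu] as soon as every admissible map [f] on [X] is [g \o s] for some
    admissible [g] on [Y]. Monomorphisms, of sets and of linearly ordered sets
    alike, are injective (test them on constant maps), so the proposition
    amounts to an extension problem along an injection [s].

    For sets, extend [f] by zero outside the image of [s]. For linear orders,
    a non-decreasing extension is needed. At a point [y] bounded above by some
    [s x], take a least one of the values [f x] with [y <= s x]; it exists because
    (DW) makes the image of a non-decreasing map well-ordered, up to the lack of
    antisymmetry of the order of [K].
    At a point [y] above the whole image of [s], take the supremum of [f],
    which exists by the standing assumption. *)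

Set Implicit Arguments.
Unset Strict Implicit.
Unset Printing Implicit Defensive.

Import Order.TTheory.
Local Open Scope classical_set_scope.

Lemma set_monomorphism_inj (X Y : Type) (s : X -> Y) :
  set_monomorphism s -> injective s.
Proof.
move=> s_mono x x' sxx'.
have e : (fun _ : unit => x) = (fun=> x').
  by apply: s_mono; apply/funext => u /=.
by have := congr1 (fun h : unit -> X => h tt) e.
Qed.

Lemma extend_along_inj (K X Y : Type) (k0 : K) (s : X -> Y) (f : X -> K) :
  injective s -> exists g : Y -> K, g \o s = f.
Proof.
move=> s_inj.
have /choice[g gP] : forall y, exists k, forall x, s x = y -> k = f x.
  move=> y.
  have [[x sxy]|no_x] := pselect (exists x, s x = y).
    by exists (f x) => x' sx'y; congr f; apply: s_inj; rewrite sxy sx'y.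
  by exists k0 => x sxy; case: no_x; exists x.
by exists g; apply/funext => x /=; exact: gP.
Qed.

Lemma pushforward_inj (K : directed_quasiring) (X Y : Type) (s : X -> Y) :
  injective s -> injective (@pushforward K X Y s).
Proof.
move=> s_inj nu mu e; apply/funext => f.
have [g <-] := extend_along_inj (qzero K) f s_inj.
exact: (congr1 (fun m : (Y -> K) -> K => m g) e).
Qed.

Lemma linear_monomorphism_inj (d d' : Order.disp_t) (X : orderType d)
    (Y : orderType d') (s : X -> Y) :
  linear_monomorphism s -> injective s.
Proof.
move=> [_ s_mono] x x' sxx'.
have e : (fun _ : bool => x) = (fun=> x').
  by apply: s_mono => [u v _|u v _|] //; apply/funext => u /=.
by have := congr1 (fun h : bool -> X => h true) e.
Qed.

Section LeastValue.
Variable K : directed_quasiring.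

(** The relation [qle] is a preorder, so distinct values may lie below each
    other; the image of a non-decreasing map is then not [linearly_ordered],
    and (DW) does not apply to it. Replacing each value by a chosen representative of its class for
    mutual comparability repairs this. *)
Definition class_repr (a : K) : K :=
  xget (qzero K : {classic K}) [set b | qle a b /\ qle b a].

Lemma class_reprP (a : K) : qle a (class_repr a) /\ qle (class_repr a) a.
Proof.
have [qlexx _ _] := qle_directed K.
exact: (@xgetPex {classic K} (qzero K) [set b | qle a b /\ qle b a]
  (ex_intro _ a (conj (qlexx a) (qlexx a)))).
Qed.

Lemma class_repr_eq (a b : K) :
  qle a b -> qle b a -> class_repr a = class_repr b.
Proof.
have [_ qle_trans _] := qle_directed K.
move=> ab ba.
suff e : [set c | qle a c /\ qle c a] = [set c | qle b c /\ qle c b].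
  by rewrite /class_repr e.
apply/seteqP; split=> c /= [lc cl].
  by split; [exact: qle_trans lc | exact: qle_trans ab].
by split; [exact: qle_trans lc | exact: qle_trans ba].
Qed.

Variables (d : Order.disp_t) (X : orderType d) (f : X -> K).
Hypothesis f_mono : nondecreasing_fun f.

Lemma class_repr_linearly_ordered :
  linearly_ordered (@qle K) (range (class_repr \o f)).
Proof.
have [_ qle_trans _] := qle_directed K.
have repr_le x y : qle (f x) (f y) -> qle (class_repr (f x)) (class_repr (f y)).
  move=> fxy; apply: (qle_trans _ _ _ (class_reprP _).2).
  exact: qle_trans fxy (class_reprP _).1.
have le_repr x y : qle (class_repr (f x)) (class_repr (f y)) -> qle (f x) (f y).
  move=> rxy; apply: (qle_trans _ _ _ (class_reprP _).1).
  exact: qle_trans rxy (class_reprP _).2.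
have anti x y : qle (class_repr (f x)) (class_repr (f y)) ->
    qle (class_repr (f y)) (class_repr (f x)) ->
    class_repr (f x) = class_repr (f y).
  by move=> xy yx; apply: class_repr_eq; exact: le_repr.
split.
- move=> _ _ _ [x _ <-] [y _ <-] [z _ <-] /= [xy nxy] [yz nyz]; split.
    exact: qle_trans yz.
  by move=> xz; apply: nxy; apply: anti => //; rewrite xz.
- by move=> _ _ [x _ <-] [y _ <-] /= [xy nxy] [yx _]; apply: nxy; exact: anti.
move=> _ _ [x _ <-] [y _ <-] /= nxy.
have [xy|yx] := leP x y.
  by left; split=> //; apply: repr_le; exact: f_mono.
right; split; last exact/nesym.
by apply: repr_le; apply: f_mono; exact: ltW.
Qed.

(** Condition (DW) puts the representatives of the values of [f] in a
    well-ordered set; representatives being equivalent to the values, a least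
    representative gives a least value. *)
Lemma nondecreasing_least_value (U : set X) : U !=set0 ->
  exists2 x0, U x0 & forall x, U x -> qle (f x0) (f x).
Proof.
have [_ qle_trans _] := qle_directed K.
move=> [x Ux].
have [B [rfB [_ B_least]]] := qle_DW class_repr_linearly_ordered.
have [||_ [[x0 Ux0 <-] x0_least]] := B_least ((class_repr \o f) @` U).
- by move=> _ [u _ <-]; apply: rfB; exists u.
- by exists (class_repr (f x)); exists x.
exists x0 => // u Uu; apply: (qle_trans _ _ _ (class_reprP _).1).
apply: (qle_trans _ _ _ _ (class_reprP _).2).
by apply: x0_least; exists u.
Qed.

End LeastValue.

(** Any least value of [f] over the points [x] with [y <= s x] may serve at [y];
    the point realizing it is prescribed to be [x] when [y = s x], so that the
    extension restricts to [f] exactly and not only up to equivalence. *)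
Lemma extend_nondecreasing (K : directed_quasiring) (d d' : Order.disp_t)
    (X : orderType d) (Y : orderType d') (s : X -> Y)
    (s_mono : nondecreasing_map s) (f : Cplus K X) :
  has_sups_l K X -> injective s ->
  exists g : Cplus K Y, Cplus_comp s_mono g = f.
Proof.
case: f => f f_mono sups s_inj; have [qlexx qle_trans _] := qle_directed K.
have [k [k_ub _]] := sups (exist _ f f_mono).
have s_le x x' : (s x <= s x')%O -> (x <= x')%O.
  move=> sxx'; case: leP => // x'x.
  have e : x = x' by apply: s_inj; apply/le_anti; rewrite sxx' s_mono // ltW.
  by rewrite e ltxx in x'x.
pose least_at y v := [/\ forall x, s x = y -> v = f x,
    forall x, (y <= s x)%O -> qle v (f x)
  & (exists2 x, (y <= s x)%O & v = f x) \/ v = k].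
have /choice[g gP] : forall y, exists v, least_at y v.
  move=> y.
  have [[x sxy]|not_im] := pselect (exists x, s x = y).
    exists (f x); split=> [x' sx'y|x'|].
    - by congr (f _); apply: s_inj; rewrite sxy sx'y.
    - by rewrite -sxy => /s_le; exact: f_mono.
    - by left; exists x => //; rewrite sxy.
  have [bounded|unbounded] := pselect (exists x, (y <= s x)%O).
    have [x0 yx0 x0_least] := nondecreasing_least_value f_mono
      (U := [set x | (y <= s x)%O]) bounded.
    exists (f x0); split=> [x sxy||]; last by left; exists x0.
      by case: not_im; exists x.
    exact: x0_least.
  exists k; split=> [x sxy|x yx|].
  - by case: not_im; exists x.
  - by case: unbounded; exists x.
  - by right.
have g_mono : nondecreasing_fun g.
  move=> y y' yy'; have [_ y_le y_val] := gP y.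
  have [_ _ [[x' y'x' ->]|->]] := gP y'.
    by apply: y_le; exact: le_trans y'x'.
  case: y_val => [[x _ ->]|->]; last exact: qlexx.
  by apply: k_ub; exists x.
exists (exist _ g g_mono); apply: eq_exist; apply/funext => x /=.
by have [+ _ _] := gP (s x); apply.
Qed.

Lemma pushforward_l_inj (K : directed_quasiring) (d d' : Order.disp_t)
    (X : orderType d) (Y : orderType d') (s : X -> Y)
    (s_mono : nondecreasing_map s) :
  has_sups_l K X -> injective s -> injective (@pushforward_l K d d' X Y s s_mono).
Proof.
move=> sups s_inj nu mu e; apply/funext => f.
have [g <-] := extend_nondecreasing s_mono f sups s_inj.
exact: (congr1 (fun m : Cplus K Y -> K => m g) e).
Qed.

Theorem proposition3p19 :
  [/\ forall K : directed_quasiring, well_ordered_quasiring K ->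
        forall (X Y : Type) (s : X -> Y),
          has_sups K X -> has_sups K Y -> set_monomorphism s ->
          injective (@O_map K X Y s),
      forall K : directed_quasiring,
        well_ordered_quasiring K -> left_distributive_quasiring K ->
        forall (X Y : Type) (s : X -> Y),
          has_sups K X -> has_sups K Y -> set_monomorphism s ->
          injective (@Oh_map K X Y s),
      forall K : directed_quasiring,
        forall (d d' : Order.disp_t) (X : orderType d) (Y : orderType d')
          (s : X -> Y) (s_mono : nondecreasing_map s),
          has_sups_l K X -> has_sups_l K Y -> linear_monomorphism s ->
          injective (@Ol_map K d d' X Y s s_mono)
    & forall K : directed_quasiring, left_distributive_quasiring K ->
        forall (d d' : Order.disp_t) (X : orderType d) (Y : orderType d')
          (s : X -> Y) (s_mono : nondecreasing_map s),
          has_sups_l K X -> has_sups_l K Y -> linear_monomorphism s ->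
          injective (@Olh_map K d d' X Y s s_mono)].
Proof.
split.
- move=> K _ X Y s _ _ /set_monomorphism_inj s_inj [nu nuP] [mu muP] [e].
  by apply: eq_exist; exact: pushforward_inj e.
- move=> K _ _ X Y s _ _ /set_monomorphism_inj s_inj [nu nuP] [mu muP] [e].
  by apply: eq_exist; exact: pushforward_inj e.
- move=> K d d' X Y s s_mono sups _ /linear_monomorphism_inj s_inj.
  move=> [nu nuP] [mu muP] [e].
  by apply: eq_exist; exact: pushforward_l_inj e.
move=> K _ d d' X Y s s_mono sups _ /linear_monomorphism_inj s_inj.
move=> [nu nuP] [mu muP] [e].
by apply: eq_exist; exact: pushforward_l_inj e.
Qed.
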